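(* Let $Q$ be a quandle consisting of $s$ orbits and fix $\mathbf{a}=(a_1,a_2,\ldots,a_s)$, with one $a_i$ chosen from each orbit, such that each $a_i$ satisfies the $k$-condition ($x*a_i^k=x$ for any $x\in Q$). Define $h'_{\mathbf{a}}\colon C_n^R(Q)\to C_{n+1}^R(Q)$ by $h'_{\mathbf{a}}=\sum_{i=1}^s h'_{a_i}$; it is a chain map, as a sum of chain maps. (1) If $Q$ is $j$-regular at each $a_i$, and each orbit of $Q$ is a quasigroup, then there is a chain map $\bar h'_{\mathbf{a}}\colon C_{n+1}^R(Q)\to C_n^R(Q)$ such that on homology $(\bar h'_{\mathbf{a}}h'_{\mathbf{a}})_*=sk^2\,\mathrm{Id}$. (2) If each orbit of $Q$ is $j$-connected to the chosen element $a_i$ in it, and $Q$ is $(j+1)$-regular at each $a_i$, then there is a chain map $\bar h'_{\mathbf{a}}\colon C_{n+1}^R(Q)\to C_n^R(Q)$ such that on homology $(\bar h'_{\mathbf{a}}h'_{\mathbf{a}})_*=sk^2\,\mathrm{Id}$. (3) In particular (under the assumptions of (1) or of (2)), if $H_n^R(Q)$ has no nonzero element of order dividing $sk$, then $(h'_{\mathbf{a}})_*\colon H_n^R(Q)\to H_{n+1}^R(Q)$ is a monomorphism.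
   Context: A quandle is a set $Q$ with a binary operation $*$ such that $a*a=a$; for all $a,b$ there is a unique $c$ with $a=c*b$; and $(a*b)*c=(a*c)*(b*c)$. Products are left-normed: $a*b*c=(a*b)*c$; $x*a^k$ means $x*a*\cdots*a$ ($k$ copies of $a$). Orbits are those of the action of $Q$ on itself by right multiplication, i.e. of the group generated by the bijections $x\mapsto x*b$, $b\in Q$. For $n\ge1$, $C_n^R(Q)=\mathbb{Z}Q^n$ with boundary $$\partial(x_1,\ldots,x_n)=\sum_{i=2}^n(-1)^i\big((x_1,\ldots,x_{i-1},x_{i+1},\ldots,x_n)-(x_1*x_i,\ldots,x_{i-1}*x_i,x_{i+1},\ldots,x_n)\big)$$ (zero for $n=1$), and homology $H_n^R(Q)$. A chain map $C_n\to C_{n+d}$ is a family of homomorphisms (over all $n$) commuting with boundaries. For $a\in Q$, $*_a(x_1,\ldots,x_n)=(x_1*a,\ldots,x_n*a)$, $h_a(x_1,\ldots,x_n)=(x_1,\ldots,x_n,a)$, and, for $a$ satisfying the $k$-condition, $h'_a=\sum_{i=0}^{k-1}( *_a)^ih_a$. An element $x_0$ is $j$-connected to $x$ if there are $x_1,\ldots,x_j\in Q$ with $x_0*x_1*\cdots*x_j=x$ (every $x$ is $0$-connected to itself). An orbit is $j$-connected to $a_i$ if each of its elements is $j$ (or less)-connected to $a_i$. An inner automorphism of length $j$ is a map $\alpha\colon Q\to Q$ of the form $\alpha(x)=x*x_1*\cdots*x_j$ with $x_1,\ldots,x_j\in Q$. $Q$ is $j$-regular at $a\in Q$ if for any two inner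 automorphisms $\alpha_1,\alpha_2$ of length $j$ such that $\alpha_1(x)=\alpha_2(x)=a$ for some $x\in Q$, we have $\alpha_1=\alpha_2$. An orbit is a quasigroup if for any $a,b$ in it the equation $a*x=b$ has exactly one solution $x$ in it. *)

(* Defs.v *)
From HB Require Import structures.
From mathcomp Require Import all_boot all_algebra.
From mathcomp Require Import boolp.
From mathcomp Require Import freeg.

Set Implicit Arguments.
Unset Strict Implicit.
Unset Printing Implicit Defensive.

Import GRing.Theory.

Local Open Scope ring_scope.
Local Open Scope quotient_scope.

Reserved Notation "x *> y" (at level 40, left associativity).

HB.mixin Record isQuandle (Q : Type) := {
  qop : Q -> Q -> Q;
  qopxx : forall a, qop a a = a;
  qop_div : forall a b, exists! c, a = qop c b;
  qop_dist : forall a b c, qop (qop a b) c = qop (qop a c) (qop b c)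
}.

#[short(type="quandleType")]
HB.structure Definition Quandle := {Q of Choice Q & isQuandle Q}.

Notation "x *> y" := (qop x y).

Section QuandleTheory.
Variable Q : quandleType.
Implicit Types (a x y : Q) (i j k : nat).

Definition k_condition k a := forall x, iter k (qop^~ a) x = x.

(* The group generated by the bijections x |-> x *> b; the last constructor
   composes with the inverse of such a bijection. *)
Inductive inner_group : (Q -> Q) -> Prop :=
| inner_id : inner_group id
| inner_mul b f : inner_group f -> inner_group (fun x => f x *> b)
| inner_div b f g :
    inner_group f -> (forall x, g x *> b = f x) -> inner_group g.

Definition qorbit a x := exists2 f, inner_group f & f a = x.

Definition connected j x0 x := exists t : j.-tuple Q, foldl qop x0 t = x.

Definition orbit_connected j a :=
  forall x, qorbit a x -> exists2 i, (i <= j)%N & connected i x a.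

Definition inner_aut j (alpha : Q -> Q) :=
  exists t : j.-tuple Q, forall x, alpha x = foldl qop x t.

Definition regular j a := forall alpha1 alpha2 : Q -> Q,
  inner_aut j alpha1 -> inner_aut j alpha2 ->
  (exists x, alpha1 x = a /\ alpha2 x = a) -> alpha1 =1 alpha2.

Definition orbit_quasigroup a := forall x y,
  qorbit a x -> qorbit a y -> exists! z, qorbit a z /\ x *> z = y.

End QuandleTheory.

Record chain_complex := ChainComplex {
  chain :> nat -> zmodType;
  diff : forall n, {additive chain n.+1 -> chain n};
  diffK : forall n x, diff n (diff n.+1 x) = 0
}.

Definition shift_complex (A : chain_complex) : chain_complex :=
  ChainComplex (fun n => @diffK A n.+1).

Definition chain_map (A B : chain_complex) (f : forall n, A n -> B n) :=
  (forall n, {morph f n : x y / x + y}) /\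
  (forall n x, diff B n (f n.+1 x) = f n (diff A n x)).

Section Homology.
Variables (A : chain_complex) (n : nat).

Definition cycle_pred : {pred A n.+1} := [pred x | diff A n x == 0].

Fact cycle_zmod_closed : zmod_closed cycle_pred.
Proof.
split=> [|x y]; rewrite !inE ?raddf0 // raddfB => /eqP-> /eqP->.
by rewrite subrr.
Qed.
HB.instance Definition _ :=
  GRing.isZmodClosed.Build (A n.+1) cycle_pred cycle_zmod_closed.

Record cycle_of := Cycle { cycle_val :> A n.+1; _ : cycle_val \in cycle_pred }.
HB.instance Definition _ := [isSub for cycle_val].
HB.instance Definition _ := [Choice of cycle_of by <:].
HB.instance Definition _ := [SubChoice_isSubZmodule of cycle_of by <:].

Definition boundary : {pred cycle_of} :=
  [pred z : cycle_of | `[< exists c, diff A n.+1 c = val z >]].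

Fact boundary_zmod_closed : zmod_closed boundary.
Proof.
split=> [|x y]; rewrite !inE.
  by apply/asboolP; exists 0; rewrite !raddf0.
move=> /asboolP[c cx] /asboolP[d dy]; apply/asboolP.
by exists (c - d); rewrite !raddfB cx dy.
Qed.
HB.instance Definition _ :=
  GRing.isZmodClosed.Build cycle_of boundary boundary_zmod_closed.

(* homology A n is H_(n+1)(A): the kernel of A_(n+1) -> A_n modulo the image
   of A_(n+2) -> A_(n+1). *)
Definition homology : zmodType := Quotient.quot boundary.

Definition hclass (z : cycle_of) : homology := \pi z.

End Homology.

(* The map f_* on H_(n+1); the default of insubd is never used when f is a
   chain map, as f then sends cycles to cycles. *)
Definition homology_map (A B : chain_complex) (f : forall n, A n -> B n) n
    (u : homology A n) : homology B n :=
  hclass (insubd (0 : cycle_of B n) (f n.+1 (val (repr u)))).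

Lemma homology_mapE (A B : chain_complex) (f : forall n, A n -> B n) n
    (z : cycle_of A n) (w : cycle_of B n) :
  chain_map f -> f n.+1 (val z) = val w ->
  homology_map f (hclass z) = hclass w.
Proof.
move=> [fD fd] fzw; rewrite /homology_map /hclass.
have f0 m : f m 0 = 0 by apply: (@addrI _ (f m 0)); rewrite -fD !addr0.
have fB m x y : f m (x - y) = f m x - f m y.
  by apply/eqP; rewrite eq_sym subr_eq -fD subrK.
set r := repr _.
have rz : boundary (z - r).
  have : z - r \in @boundary A n by rewrite Quotient.idealrBE reprK.
  by [].
have fr : f n.+1 (val r) \in @cycle_pred B n.
  by rewrite inE fd (eqP (valP r)) f0.
apply/esym/eqP; rewrite -Quotient.idealrBE inE; apply/asboolP.
move/asboolP: rz => [c dc]; exists (f n.+2 c).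
by rewrite fd dc !raddfB /= insubdK // fB fzw.
Qed.

Section RackComplex.
Variable Q : quandleType.
Implicit Types (a : Q) (n k : nat).

Definition rack_chain n : zmodType := {freeg (n.-tuple Q) / int}.

Definition extend m n (f : m.-tuple Q -> rack_chain n) :
  rack_chain m -> rack_chain n := fglift f.

HB.instance Definition _ m n (f : m.-tuple Q -> rack_chain n) :=
  GRing.isZmodMorphism.Build (rack_chain m) (rack_chain n) (extend f)
    (lift_is_additive f).

(* With 0-based indices: face false i drops the entry x_i, and face true i
   also multiplies the entries before it by x_i. *)
Definition face (e : bool) n (i : 'I_n.+1) (x : n.+1.-tuple Q) : n.-tuple Q :=
  [tuple if e && (j < i)%N then tnth x (fintype.lift i j) *> tnth x i
         else tnth x (fintype.lift i j) | j < n].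

(* The exponent i.+1 is the index of x_i counted from 1. *)
Definition rack_diff n : {additive rack_chain n.+1 -> rack_chain n} :=
  extend (fun x : n.+1.-tuple Q => \sum_(i < n.+1 | (0 < i)%N)
    (-1) ^+ i.+1 *: (<< face false i x >> - << face true i x >>)).

Lemma extendU m n (f : m.-tuple Q -> rack_chain n) x : extend f << x >> = f x.
Proof. by rewrite /extend liftU scale1r. Qed.

Lemma eq_additive m n (f g : {additive rack_chain m -> rack_chain n}) :
  (forall x : m.-tuple Q, f << x >> = g << x >>) -> f =1 g.
Proof.
move=> fg c; rewrite -[c]freeg_sumE !raddf_sum; apply: eq_bigr => x _.
by rewrite -[coeff x c]intz -freegU_mulz !raddfMz fg.
Qed.

Lemma face_face e1 e2 n (i : 'I_n.+2) (j : 'I_n.+1) (i' : 'I_n.+1) (j' : 'I_n.+2)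
   (x : n.+2.-tuple Q) : (j < i)%N -> j' = j :> nat -> i'.+1 = i :> nat ->
  face e2 j (face e1 i x) = face e1 i' (face e2 j' x).
Proof.
move=> ltji ej ei; apply: eq_from_tnth => l; rewrite !tnth_mktuple /=.
pose X := nth (thead x) x.
have E m : tnth x m = X m by rewrite (tnth_nth (thead x)).
have bE h k : bump h k = if (h <= k)%N then k.+1 else k.
  by rewrite /bump; case: leqP; rewrite ?add0n ?add1n.
rewrite !E /= ej -ei !ltnS !bE.
have {}ltji : (j <= i')%N by rewrite -ltnS ei.
rewrite ltji (ltnNge i' j) ltji (ltnNge l j).
case: (leqP j l) => jl /=; last first.
  have li := leq_trans jl ltji.
  rewrite (leqNgt i' l) li (leqNgt j l) jl /= (ltnNge i' l) (ltnW li) /=.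
  by case: e1; case: e2 => //=; rewrite -qop_dist.
rewrite !andbF; have [il|li] := leqP i' l => /=.
  by rewrite !andbF ltnS il (ltnNge _ j) (leqW jl) andbF.
by rewrite ltnS (leqNgt i' l) li /= jl ltnNge jl !andbF.
Qed.

Lemma rack_diffK n x : rack_diff n (rack_diff n.+1 x) = 0.
Proof.
apply: (@eq_additive _ _ (rack_diff n \o rack_diff n.+1) \0) => {}x /=.
rewrite extendU raddf_sum /=.
pose t e1 e2 (i : 'I_n.+2) (j : 'I_n.+1) : rack_chain n :=
  << face e2 j (face e1 i x) >>.
pose G (i : 'I_n.+2) (j : 'I_n.+1) : rack_chain n := (-1) ^+ (i + j) *:
  (t false false i j - t false true i j - t true false i j + t true true i j).
transitivity (\sum_(i < n.+2 | (0 < i)%N) \sum_(j < n.+1 | (0 < j)%N) G i j).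
  apply: eq_bigr => i _; rewrite raddfZsign raddfB /= !extendU -sumrB.
  rewrite scaler_sumr; apply: eq_bigr => j _; rewrite -!scalerBr scalerA.
  rewrite -exprD addSn addnS !exprS mulrA mulN1r opprK mul1r; congr (_ *: _).
  by rewrite opprB addrA addrAC.
rewrite pair_big_dep /= (bigID (fun p : 'I_n.+2 * 'I_n.+1 => p.2 < p.1)%N) /=.
rewrite addrC (reindex_onto
  (fun p : 'I_n.+2 * 'I_n.+1 => (widen_ord (leqnSn _) p.2, inord p.1.-1))
  (fun p => (fintype.lift ord0 p.2, inord p.1))) /=; last first.
  move=> [i j] /= /andP[/andP[i0 j0]]; rewrite -leqNgt => ij.
  congr pair; apply: val_inj => /=; rewrite ?lift0 ?inordK //=.
    exact: leq_ltn_trans ij (ltn_ord j).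
  exact: (ltn_ord j).
apply/eqP; rewrite addr_eq0; apply/eqP.
have iK (i : 'I_n.+2) : (0 < i)%N -> (inord i.-1 : 'I_n.+1) = i.-1 :> nat.
  by move=> i0; rewrite inordK // -ltnS prednK.
rewrite -sumrN; apply: eq_big => [[i j]|[i j]] /=.
  case: (posnP i) => [i0|i0].
    rewrite i0 ltn0 !andbF /=; apply/negP => /andP[_ /eqP[/(congr1 val)]].
    by rewrite /= i0.
  have ltE : (j < i)%N = (j <= i.-1)%N by rewrite -[in LHS](prednK i0) ltnS.
  rewrite iK // -leqNgt ltE.
  have -> : (fintype.lift ord0 (inord i.-1 : 'I_n.+1), inord j) == (i, j).
    apply/eqP; congr pair; apply: val_inj.
      by rewrite -[LHS]/(bump 0 (inord i.-1 : 'I_n.+1)) /bump iK // add1n prednK.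
    exact: (inordK (ltn_ord j)).
  rewrite andbT; case: (posnP j) => //= j0.
  by case: (leqP j) => ij; rewrite ?andbF ?andbT // (leq_trans j0 ij).
move=> /andP[/andP[/andP[j0 i'0] ij]] _.
have i0 : (0 < i)%N.
  by case: (posnP i) => // i0; rewrite i0 /= inordK in i'0.
move: ij; rewrite -leqNgt iK // => ij.
have t_sym e1 e2 : t e1 e2 (widen_ord (leqnSn _) j) (inord i.-1) = t e2 e1 i j.
  congr (<< _ >>); apply/esym/face_face; rewrite ?iK ?prednK //.
  by rewrite -[i in (_ < i)%N]/(nat_of_ord i) -(prednK i0) ltnS.
have sgn : (-1) ^+ (j + i.-1) = - (-1) ^+ (i + j) :> int.
  by rewrite -[in RHS](prednK i0) addSn exprS mulN1r opprK addnC.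
rewrite /G !t_sym /= iK // sgn scaleNr; congr (- (_ *: (_ + _))).
exact: addrAC.
Qed.

(* Degree 0 is Z Q^0 with zero boundary C_1 -> C_0, so that H_1 is the cokernel
   of C_2 -> C_1; homology is only taken in degrees n >= 1. *)
Definition rack_complex : chain_complex := ChainComplex rack_diffK.

Definition star a n : rack_chain n -> rack_chain n :=
  extend (fun x : n.-tuple Q => << map_tuple (qop^~ a) x >>).

Definition append a n : rack_chain n -> rack_chain n.+1 :=
  extend (fun x : n.-tuple Q => << rcons_tuple x a >>).

Definition hprime1 k a n (c : rack_chain n) : rack_chain n.+1 :=
  \sum_(i < k) iter i (@star a n.+1) (append a c).

Definition hprime k s (a : 'I_s -> Q) n
    (c : rack_complex n) : shift_complex rack_complex n :=
  \sum_(i < s) hprime1 k (a i) c.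

End RackComplex.

(* Main.v *)
From HB Require Import structures.
Require Import Defs.
From mathcomp Require Import all_boot all_algebra.
From mathcomp Require Import boolp freeg.

Set Implicit Arguments.
Unset Strict Implicit.
Unset Printing Implicit Defensive.

Import GRing.Theory.

Local Open Scope ring_scope.

(** Write x * y for x *> y, and N_c for the sum of the first k powers of the
translation by c acting entrywise on chains.  Then h'_a (x) = N_a (x, a), and the
terms of the boundary that delete the last entry a cancel under N_a because its
k-th power is the identity; so h'_a is a chain map.  The map h_y, which appends y,
is a chain homotopy from the translation by y to the identity
([diff_append], [star_homologous]).  Therefore every inner automorphism acts
trivially on homology and N_c acts as multiplication by k.  It is enough to find a
chain map hbar such that, for each i, hbar h'_(a_i) is N_c N_c up to inner
automorphisms ([hbar_of_words]): summing over i gives the factor s * k ^ 2, and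
injectivity of h' follows by cancelling s * k twice ([homology_map_inj]).

When orbits are j-connected and Q is (j+1)-regular, let a_u be the chosen
point in the orbit of u, choose for each u an inner automorphism w_u of length j
that takes u to a_u, and set hbar (x, u) = N_(a_u) (w_u x).  The only boundary
terms that could obstruct this are hbar (x) - hbar (x * u); they vanish because
x |-> w_(v * u) (x * u) and x |-> (w_v x) * a_v have length j + 1 and both take
v to a_v, so that they are equal by regularity ([regular_hbar_dw]).

When the orbits are quasigroups, that formula works if j > 1 but not for j = 1:
a connected Latin quandle is always 1-regular, while inner automorphisms of length
2 that agree at a point may differ.  Instead, regularity and the quasigroup
property show that each translation of Q is a translation by an element of any
prescribed orbit ([quasigroup_translation]).  Fix c = a_0.  Every orbit then
contains a point b_i which acts as c does, and the b_i are fixed by c.  Let beta x be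
the b_i in the orbit of x.  For a word x and a nonempty set of positions
p_1 < ... < p_r, delete these entries of x and append
beta x_(p_r), ..., beta x_(p_2); hbar is N_c applied to the signed sum of the results
([common_hbar]).  Deletions commute with faces up to sign, and
the appended letters, which are fixed by c and act as c does, contribute nothing to the
boundary under N_c; so hbar is a chain map.  On a word (x, b_i), the position set P
without the last position and P together with it give the same word with opposite signs.
Only the singleton of the last position survives, and
hbar (x, b_i) = N_c x ([common_hbar_app]).  Finally a_i * w = b_i for some w, so that
h'_(a_i) and h'_(b_i) agree up to translation by w. *)

(** * Chains of words *)

Section LinearExtension.
Variables K L : choiceType.

Definition lin (f : K -> {freeg L / int}) : {freeg K / int} -> {freeg L / int} :=
  fglift f.

HB.instance Definition _ f := GRing.isZmodMorphism.Build
  {freeg K / int} {freeg L / int} (lin f) (lift_is_additive f).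

Lemma linU f x : lin f << x >> = f x.
Proof. by rewrite /lin liftU scale1r. Qed.

Lemma eq_lin (V : zmodType) (f g : {additive {freeg K / int} -> V}) :
  (forall x : K, f << x >> = g << x >>) -> f =1 g.
Proof.
move=> fg c; rewrite -[c]freeg_sumE !raddf_sum; apply: eq_bigr => x _.
by rewrite -[coeff x c]intz -freegU_mulz !raddfMz fg.
Qed.

End LinearExtension.

Lemma iter_raddf (V : zmodType) (f : {additive V -> V}) n :
  GRing.additive (iter n f).
Proof. by elim: n => [|n IH] x y //=; rewrite IH raddfB. Qed.

HB.instance Definition _ (V : zmodType) (f : {additive V -> V}) n :=
  GRing.isZmodMorphism.Build V V (iter n f) (iter_raddf f n).

(** Chains of all lengths live in the free abelian group on words, so that recursion
on a word, with a prefix carried along, involves no arithmetic on tuple lengths. *)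
Section Words.
Variable Q : quandleType.
Implicit Types (p q x : seq Q) (y z b c : Q) (g : Q -> Q) (k n r t : nat).

Local Notation chain := {freeg (seq Q) / int}.
Implicit Types u v : chain.

Definition quandle_morphism g := {morph g : x y / x *> y}.

Lemma qop_morphism y : quandle_morphism (qop^~ y).
Proof. by move=> a b; rewrite /= qop_dist. Qed.

Lemma iter_morphism g n : quandle_morphism g -> quandle_morphism (iter n g).
Proof. by move=> gM; elim: n => // n IH a b; rewrite !iterS IH gM. Qed.

Definition act g : chain -> chain := lin (fun x => << map g x >>).
Definition pre p : chain -> chain := lin (fun x => << p ++ x >>).
Definition app b : chain -> chain := lin (fun x => << rcons x b >>).

HB.instance Definition _ g := GRing.Additive.on (act g).
HB.instance Definition _ p := GRing.Additive.on (pre p).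
HB.instance Definition _ b := GRing.Additive.on (app b).

Lemma actU g x : act g << x >> = << map g x >>. Proof. exact: linU. Qed.
Lemma preU p x : pre p << x >> = << p ++ x >>. Proof. exact: linU. Qed.
Lemma appU b x : app b << x >> = << rcons x b >>. Proof. exact: linU. Qed.

Lemma pre_nil u : pre [::] u = u.
Proof. by apply: (@eq_lin _ _ (pre [::]) idfun) => x /=; rewrite preU. Qed.

Lemma pre_pre p q u : pre p (pre q u) = pre (p ++ q) u.
Proof.
apply: (@eq_lin _ _ (pre p \o pre q) (pre (p ++ q))) => x /=.
by rewrite !preU catA.
Qed.

Lemma app_pre b p u : app b (pre p u) = pre p (app b u).
Proof.
apply: (@eq_lin _ _ (app b \o pre p) (pre p \o app b)) => x /=.
by rewrite !(preU, appU) rcons_cat.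
Qed.

Lemma act_act g1 g2 u : act g1 (act g2 u) = act (g1 \o g2) u.
Proof.
apply: (@eq_lin _ _ (act g1 \o act g2) (act (g1 \o g2))) => x /=.
by rewrite !actU map_comp.
Qed.

Lemma eq_act g1 g2 u : g1 =1 g2 -> act g1 u = act g2 u.
Proof.
by move=> eg; apply: (@eq_lin _ _ (act g1) (act g2)) => x /=; rewrite !actU (eq_map eg).
Qed.

Lemma act_app g b u : act g (app b u) = app (g b) (act g u).
Proof.
apply: (@eq_lin _ _ (act g \o app b) (app (g b) \o act g)) => x /=.
by rewrite !(actU, appU) map_rcons.
Qed.

Lemma act_id u : act id u = u.
Proof. by apply: (@eq_lin _ _ (act id) idfun) => x /=; rewrite actU map_id. Qed.

Lemma iter_act g n u : iter n (act g) u = act (iter n g) u.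
Proof.
by elim: n => [|n IH] /=; [rewrite act_id | rewrite IH act_act].
Qed.

(** The alternating sum of the faces at the entries of x in the word p ++ x. Keeping
the prefix p, on which these faces act, makes it recursive in the first letter of x;
the rack boundary is its opposite for an empty prefix, as the two faces at the first
entry of a word agree. *)
Fixpoint bd p x : chain :=
  if x is y :: x' then << p ++ x' >> - << map (qop^~ y) p ++ x' >> - bd (rcons p y) x'
  else 0.

Definition bdl p : chain -> chain := lin (bd p).
HB.instance Definition _ p := GRing.Additive.on (bdl p).

Lemma bdlU p x : bdl p << x >> = bd p x. Proof. exact: linU. Qed.

Lemma bdl_cons p y u :
  bdl p (pre [:: y] u) = pre p u - pre (map (qop^~ y) p) u - bdl (rcons p y) u.
Proof.
apply: (@eq_lin _ _ (bdl p \o pre [:: y])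
  ((pre p \- pre (map (qop^~ y) p)) \- bdl (rcons p y))) => x /=.
by rewrite !(preU, bdlU).
Qed.

Lemma bd_rcons p x b :
  bd p (rcons x b) = app b (bd p x)
    + (-1) ^+ size x *: (<< p ++ x >> - << map (qop^~ b) (p ++ x) >>).
Proof.
elim: x p => [|y x IH] p /=.
  by rewrite !cats0 !raddf0 addr0 add0r expr0 scale1r.
rewrite IH !raddfB /= !appU !rcons_cat exprS mulN1r scaleNr !cat_rcons opprD.
by rewrite !map_cat /= !scaleNr !opprD !opprK !addrA.
Qed.

Lemma act_bd g p x : quandle_morphism g -> act g (bd p x) = bd (map g p) (map g x).
Proof.
move=> gM; elim: x p => [|y x IH] p /=; first by rewrite raddf0.
rewrite !raddfB /= !actU !map_cat IH map_rcons; congr (_ - << _ ++ _ >> - _).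
by rewrite -!map_comp; apply: eq_map => z /=; rewrite gM.
Qed.

Definition dw : chain -> chain := \- (bdl [::]).
HB.instance Definition _ := GRing.Additive.on dw.

Lemma dw_act g u : quandle_morphism g -> dw (act g u) = act g (dw u).
Proof.
move=> gM; rewrite /dw /= raddfN; congr (- _).
apply: (@eq_lin _ _ (bdl [::] \o act g) (act g \o bdl [::])) => x /=.
by rewrite actU !bdlU act_bd.
Qed.

(** * Deleting letters when one translation is available in every orbit *)

Section CommonTranslation.
Variables (k : nat) (c : Q) (beta : Q -> Q).
Hypothesis ck : k_condition k c.
Hypothesis beta_fix : forall y, beta y *> c = beta y.
Hypothesis beta_qop : forall y z, beta (y *> z) = beta y.
Hypothesis qop_beta : forall y z, y *> beta z = y *> c.

Definition norm u : chain := \sum_(t < k) iter t (act (qop^~ c)) u.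

Lemma norm_additive : GRing.additive norm.
Proof. by move=> u v; rewrite -sumrB; apply: eq_bigr => t _; rewrite raddfB. Qed.

HB.instance Definition _ := GRing.isZmodMorphism.Build chain chain norm norm_additive.

(** The k-condition makes the translates in the sum cyclically permuted. *)
Lemma norm_act u : norm (act (qop^~ c) u) = norm u.
Proof.
have ik : iter k (act (qop^~ c)) u = u.
  rewrite iter_act; apply: (@eq_lin _ _ (act (iter k (qop^~ c))) idfun) => x /=.
  by rewrite actU (eq_map (ck : iter k _ =1 id)) map_id.
rewrite /norm; under eq_bigr do rewrite -iterSr.
case: k ik => [|m] ik; first by rewrite !big_ord0.
by rewrite big_ord_recr big_ord_recl /= -iterS ik addrC.
Qed.

Lemma norm_app y u : norm (app (beta y) u) = app (beta y) (norm u).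
Proof.
rewrite raddf_sum; apply: eq_bigr => t _; rewrite !iter_act act_app; congr (app _ _).
by elim: (t : nat) => //= n ->.
Qed.

Lemma norm_dw u : dw (norm u) = norm (dw u).
Proof.
rewrite /norm (raddf_sum dw); apply: eq_bigr => t _.
by rewrite /= !iter_act dw_act //; apply/iter_morphism/qop_morphism.
Qed.

(** The two faces at a final letter beta y differ by the translation by c, which norm
does not see; hence appended letters of this kind are transparent to boundaries. *)
Lemma norm_bdl_app p y u : norm (bdl p (app (beta y) u)) = norm (app (beta y) (bdl p u)).
Proof.
apply: (@eq_lin _ _ (norm \o bdl p \o app (beta y)) (norm \o app (beta y) \o bdl p)).
move=> x /=; rewrite appU !bdlU bd_rcons (raddfD norm) (raddfZsign norm) (raddfB norm) /=.
rewrite (eq_map (fun z => qop_beta z y)) -actU norm_act subrr scaler0 addr0.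
by [].
Qed.

(** The signed sum, over all sets of positions, of the words obtained by deleting
the letters at these positions and appending their images under beta in reverse
order. The sign of a deletion depends on the distance to the right end of the word,
so that it is not affected by the letters on the left. *)
Fixpoint swap_out x : chain :=
  if x is y :: x' then
    pre [:: y] (swap_out x') + (-1) ^+ size x *: app (beta y) (swap_out x')
  else << [::] >>.

(** The same sum over nonempty sets of positions, with the leftmost deleted letter not
appended again; it lowers the length by one. *)
Fixpoint drop_out x : chain :=
  if x is y :: x' then
    pre [:: y] (drop_out x') + (-1) ^+ size x *: swap_out x'
  else 0.

(** Faces at the letters of x also act on the prefix p, so the sum bd p x mixes
prefixes; all of them have the length of p, and this operator applies F behind them. *)
Definition after r (F : seq Q -> chain) : chain -> chain :=
  lin (fun x => pre (take r x) (F (drop r x))).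
HB.instance Definition _ r F := GRing.Additive.on (after r F).

Lemma afterU r F p x : size p = r -> after r F << p ++ x >> = pre p (F x).
Proof. by move=> <-; rewrite /after linU take_size_cat // drop_size_cat. Qed.

(** The maps swap_out and drop_out satisfy the same recursion: T y appends beta y in the
first case and is the identity in the second. *)
Section Recursion.
Variables (F : seq Q -> chain) (T : Q -> {additive chain -> chain}).
Hypothesis F_cons : forall y x,
  F (y :: x) = pre [:: y] (F x) + (-1) ^+ (size x).+1 *: T y (swap_out x).
Hypothesis T_qop : forall y z u, T (y *> z) u = T y u.
Hypothesis T_pre : forall y p u, T y (pre p u) = pre p (T y u).
Hypothesis T_norm : forall y u, norm (T y u) = T y (norm u).
Hypothesis T_bdl : forall y p u, norm (bdl p (T y u)) = norm (T y (bdl p u)).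

Lemma after_consU r p y x : size p = r ->
  after r F << p ++ y :: x >> = after r.+1 F << p ++ y :: x >>
    + (-1) ^+ (size x).+1 *: T y (after r swap_out << p ++ x >>).
Proof.
move=> pr; rewrite !(@afterU r) // F_cons (raddfD (pre p)) (raddfZsign (pre p)) /=.
by rewrite T_pre pre_pre cats1 -cat_rcons afterU // size_rcons pr.
Qed.

(** In the faces of p ++ y :: q at the letters of x, either y is skipped by F or it is
deleted, leaving a face of p ++ q. Only the orbit of y matters for T y, so the faces
that translate y cause no discrepancy. *)
Lemma after_bd r p y q x : size p = r ->
  after r F (bd (p ++ y :: q) x)
  = after r.+1 F (bd (p ++ y :: q) x)
    + (-1) ^+ (size q + size x) *: T y (after r swap_out (bd (p ++ q) x)).
Proof.
elim: x p y q => [|z x IH] p y q pr /=; first by rewrite !raddf0 addr0.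
rewrite !raddfB /= !map_cat /= -!catA /= !(@after_consU r) ?size_map // T_qop.
rewrite !rcons_cat /= IH // !size_cat size_rcons size_map addnS addSn.
have regroup (a b d e f h : chain) :
  a + b - (d + e) - (f + h) = a - d - f + (b - e - h).
  by rewrite !opprD [a + b + _]addrACA; apply: addrACA.
exact: regroup.
Qed.

(** The inductive step of the commutation with faces. The faces at y match. A term
where y is deleted carries a sign that changes when a letter of x is removed, because
y is then one step closer to the right end; this is compensated by the sign
in front of the last term of bd p (y :: x). *)
Lemma norm_bdl_cons r p y x : size p = r ->
  (forall p r, size p = r -> norm (bdl p (F x)) = norm (after r F (bd p x))) ->
  (forall p r, size p = r ->
    norm (bdl p (swap_out x)) = norm (after r swap_out (bd p x))) ->
  norm (bdl p (F (y :: x))) = norm (after r F (bd p (y :: x))).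
Proof.
move=> pr Fx Wx.
rewrite F_cons (raddfD (bdl p)) (raddfZsign (bdl p)) (raddfD norm) (raddfZsign norm) /=.
rewrite bdl_cons T_bdl T_norm (Wx _ r) // -T_norm.
rewrite !(raddfB (after r F)) /= !(@afterU r) ?size_map //.
rewrite -cats1 after_bd // cats0 add0n cats1.
rewrite !(raddfB norm) (raddfD norm) (raddfZsign norm) /= (Fx _ r.+1) ?size_rcons ?pr //.
by rewrite exprS mulN1r scaleNr opprD addrA.
Qed.
End Recursion.

(** Keeping the final b and deleting it in order to append beta b = b give the same word
with opposite signs. *)
Lemma swap_out_rcons x b : beta b = b -> swap_out (rcons x b) = 0.
Proof.
move=> bb; elim: x => [|y x IH] /=; last by rewrite IH !raddf0 addr0.
by rewrite preU appU bb expr1 scaleN1r subrr.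
Qed.

Lemma drop_out_rcons x b : beta b = b -> drop_out (rcons x b) = - << x >>.
Proof.
move=> bb; elim: x => [|y x IH] /=.
  by rewrite raddf0 add0r expr1 scaleN1r.
by rewrite IH swap_out_rcons // raddf0 addr0 raddfN /= preU.
Qed.

Lemma norm_bdl_swap_out r p x : size p = r ->
  norm (bdl p (swap_out x)) = norm (after r swap_out (bd p x)).
Proof.
elim: x p r => [|y x IH] p r pr; first by rewrite /= bdlU !raddf0.
apply: (@norm_bdl_cons swap_out (fun y => app (beta y))) => //.
- by move=> z w u; rewrite beta_qop.
- by move=> *; apply: app_pre.
- exact: norm_app.
- by move=> *; apply: norm_bdl_app.
Qed.

Lemma norm_bdl_drop_out r p x : size p = r ->
  norm (bdl p (drop_out x)) = norm (after r drop_out (bd p x)).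
Proof.
elim: x p r => [|y x IH] p r pr; first by rewrite /= !raddf0.
by apply: (@norm_bdl_cons drop_out (fun=> idfun)) => // *; apply: norm_bdl_swap_out.
Qed.

Definition common_hbar u := - norm (lin drop_out u).

Lemma common_hbar_additive : GRing.additive common_hbar.
Proof. by move=> u v; rewrite /common_hbar !raddfB. Qed.
HB.instance Definition _ :=
  GRing.isZmodMorphism.Build chain chain common_hbar common_hbar_additive.

Lemma common_hbar_dw u : dw (common_hbar u) = common_hbar (dw u).
Proof.
rewrite /common_hbar (raddfN dw) /= norm_dw /dw /=; congr (- _).
rewrite (raddfN norm) (raddfN (lin drop_out)) (raddfN norm) /=; congr (- _).
apply: (@eq_lin _ _ (norm \o bdl [::] \o lin drop_out)
                    (norm \o lin drop_out \o bdl [::])) => x /=.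
rewrite linU bdlU (@norm_bdl_drop_out 0) //; congr (norm _).
apply: (@eq_lin _ _ (after 0 drop_out) (lin drop_out)) => z /=.
by rewrite -[z in LHS]cat0s (@afterU 0) // pre_nil linU.
Qed.

(** In drop_out, the cancellation of swap_out_rcons leaves only the deletion of the
final b alone. *)
Lemma common_hbar_app b u : beta b = b -> common_hbar (app b u) = norm u.
Proof.
move=> bb; rewrite /common_hbar; suff -> : lin drop_out (app b u) = - u.
  by rewrite (raddfN norm) opprK.
apply: (@eq_lin _ _ (lin drop_out \o app b) (\- idfun)) => x /=.
by rewrite appU linU drop_out_rcons.
Qed.

End CommonTranslation.

Lemma norm_app_self k b u : norm k b (app b u) = app b (norm k b u).
Proof.
rewrite /norm (raddf_sum (app b)); apply: eq_bigr => t _ /=.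
rewrite !iter_act act_app; congr (app _ _).
by elim: (t : nat) => //= n ->; rewrite qopxx.
Qed.

Lemma eq_norm k b c u : (forall y, y *> b = y *> c) -> norm k b u = norm k c u.
Proof.
move=> bc; apply: eq_bigr => t _; apply: eq_iter => v; exact: eq_act.
Qed.

Lemma act_norm g k b u : quandle_morphism g -> act g (norm k b u) = norm k (g b) (act g u).
Proof.
move=> gM; rewrite /norm (raddf_sum (act g)); apply: eq_bigr => t _ /=.
elim: (t : nat) => //= n <-; rewrite !act_act; apply: eq_act => y /=; exact: gM.
Qed.

(** * Moving the last letter to a base point *)

Section RegularTranslation.
Variables (k : nat) (base : Q -> Q) (w : Q -> seq Q).
Hypothesis base_k : forall y, k_condition k (base y).
Hypothesis base_qop : forall y z, base (y *> z) = base y.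
Hypothesis w_regular : forall y z b,
  foldl qop (b *> z) (w (y *> z)) = foldl qop b (w y) *> base y.

Lemma foldl_morphism x : quandle_morphism (foldl qop ^~ x).
Proof. by elim: x => //= y x IH a b; rewrite qop_dist IH. Qed.

Definition last_hbar x : chain :=
  if x is y :: x' then
    let u := last y x' in
    norm k (base u) (act (foldl qop ^~ (w u)) << belast y x' >>)
  else 0.

Definition regular_hbar : chain -> chain := lin last_hbar.
HB.instance Definition _ := GRing.Additive.on regular_hbar.

Lemma regular_hbarU x : regular_hbar << x >> = last_hbar x. Proof. exact: linU. Qed.

Lemma regular_hbar_app b u :
  regular_hbar (app b u) = norm k (base b) (act (foldl qop ^~ (w b)) u).
Proof.
apply: (@eq_lin _ _ (regular_hbar \o app b)
   (norm k (base b) \o act (foldl qop ^~ (w b)))) => x /=.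
rewrite appU regular_hbarU.
by case: x => //= y x; rewrite last_rcons belast_rcons.
Qed.

(** By w_regular the two sides differ by the translation by the base point of the last
letter, which norm does not see. *)
Lemma last_hbar_act x y : last_hbar (map (qop^~ y) x) = last_hbar x.
Proof.
case: x => //= z x; rewrite (last_map (qop^~ y)) (belast_map (qop^~ y)) base_qop -actU act_act.
set v := last z x; rewrite -[RHS]norm_act ?act_act; last exact: base_k.
by congr (norm _ _ _); apply: eq_act => b /=; rewrite w_regular.
Qed.

(** Faces other than those at the last letter y commute with the translations;
the faces at y cancel by last_hbar_act. *)
Lemma regular_hbar_dw u : dw (regular_hbar u) = regular_hbar (dw u).
Proof.
apply: (@eq_lin _ _ (dw \o regular_hbar) (regular_hbar \o dw)) => x /=.
rewrite {2}/dw /= bdlU; case/lastP: x => [|x y].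
  by rewrite /= regular_hbarU !raddf0.
rewrite bd_rcons (raddfN regular_hbar) (raddfD regular_hbar) (raddfZsign regular_hbar).
rewrite (raddfB regular_hbar) /= -(appU y x).
rewrite !regular_hbar_app !regular_hbarU last_hbar_act subrr scaler0 addr0.
rewrite norm_dw dw_act; last exact: foldl_morphism.
by rewrite /dw /= bdlU !raddfN.
Qed.

End RegularTranslation.
End Words.

(** * From words to the rack complex *)

Section RackChains.
Variable Q : quandleType.
Local Notation chain := {freeg (seq Q) / int}.

Lemma bd_tuple n (x : n.-tuple Q) (p : seq Q) :
  bd p x = \sum_(i < n) (-1) ^+ i *: (<< p ++ take i x ++ drop i.+1 x >>
    - << map (qop^~ (tnth x i)) (p ++ take i x) ++ drop i.+1 x >>).
Proof.
elim: n x p => [|n IH] x p; first by rewrite big_ord0 tuple0.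
case/tupleP: x => y x; rewrite big_ord_recl /= expr0 scale1r cats0 drop0 IH.
rewrite tnth0 -sumrN; congr (_ + _); apply: eq_bigr => i _.
by rewrite tnthS exprS mulN1r scaleNr cat_rcons -cats1 -catA.
Qed.

Lemma val_face e n (i : 'I_n.+1) (x : n.+1.-tuple Q) :
  val (face e i x)
  = (if e then map (qop^~ (tnth x i)) (take i x) else take i x) ++ drop i.+1 x.
Proof.
have si : size (take i x) = i by rewrite size_takel // size_tuple ltnW.
have sl : size (if e then map (qop^~ (tnth x i)) (take i x) else take i x) = i.
  by case: e; rewrite ?size_map si.
apply: (@eq_from_nth _ (tnth x i)) => [|j].
  by rewrite size_tuple size_cat sl size_drop size_tuple subSS subnKC // -ltnS.
rewrite size_tuple => jn; rewrite -(tnth_nth _ _ (Ordinal jn)) tnth_mktuple /=.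
set d := tnth x i; have xE m : tnth x m = nth d x m by apply: tnth_nth.
rewrite nth_cat sl !xE /= nth_drop.
case: (ltnP j i) => ji; rewrite /bump.
  rewrite leqNgt ji andbT add0n; case: e {sl}; rewrite ?(nth_map d) ?si //=.
    by rewrite nth_take.
  by rewrite nth_take.
by rewrite ji andbF add1n addSn subnKC.
Qed.

Definition forget n : rack_chain Q n -> chain := lin (fun x : n.-tuple Q => << val x >>).
HB.instance Definition _ n := GRing.isZmodMorphism.Build (rack_chain Q n) chain
  (@forget n) (lift_is_additive _).

Definition truncate n : chain -> rack_chain Q n :=
  lin (fun x : seq Q => if insub x is Some t then << t : n.-tuple Q >> else 0).
HB.instance Definition _ n := GRing.isZmodMorphism.Build chain (rack_chain Q n)
  (@truncate n) (lift_is_additive _).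

Lemma forgetU n (x : n.-tuple Q) : forget << x >> = << val x >>.
Proof. exact: linU. Qed.

Lemma truncateU n (x : n.-tuple Q) : truncate n << val x >> = << x >>.
Proof. by rewrite /truncate linU valK. Qed.

Lemma eq_rack n (V : zmodType) (f g : {additive rack_chain Q n -> V}) :
  (forall x : n.-tuple Q, f << x >> = g << x >>) -> f =1 g.
Proof. exact: eq_lin. Qed.

Lemma forgetK n : cancel (@forget n) (truncate n).
Proof.
by apply: (@eq_rack _ _ (truncate n \o @forget n) idfun) => x /=; rewrite forgetU truncateU.
Qed.

(** Chains of words of length n, expressed as the fixed points of a projection so that
closure properties are equational. *)
Definition homog n (u : chain) := forget (truncate n u) = u.

Lemma homogU n x : size x = n -> homog n << x >>.
Proof.
by move=> /eqP xn; rewrite /homog -[x]/(val (Tuple xn)) truncateU forgetU.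
Qed.

Lemma homogD n u v : homog n u -> homog n v -> homog n (u + v).
Proof. by rewrite /homog !raddfD /= => -> ->. Qed.

Lemma homogN n u : homog n u -> homog n (- u).
Proof. by rewrite /homog !raddfN /= => ->. Qed.

Lemma homog0 n : homog n 0. Proof. by rewrite /homog !raddf0. Qed.

Lemma homogZsign n m u : homog n u -> homog n ((-1) ^+ m *: u).
Proof. by rewrite /homog !raddfZsign /= => ->. Qed.

Lemma homog_sum n (I : Type) (r : seq I) (F : I -> chain) :
  (forall i, homog n (F i)) -> homog n (\sum_(i <- r) F i).
Proof.
by move=> hF; elim/big_ind: _ => //; [apply: homog0 | apply: homogD].
Qed.

Lemma forget_homog m n (F : {additive chain -> chain}) (c : rack_chain Q m) :
  (forall x, size x = m -> homog n (F << x >>)) -> homog n (F (forget c)).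
Proof.
move=> hF; rewrite /homog.
apply: (@eq_rack _ _ (@forget n \o truncate n \o F \o @forget m) (F \o @forget m)).
by move=> x /=; rewrite forgetU hF ?size_tuple.
Qed.

Lemma homog_additive m n (F : {additive chain -> chain}) u :
  (forall x, size x = m -> homog n (F << x >>)) -> homog m u -> homog n (F u).
Proof. by move=> hF <-; apply: forget_homog. Qed.

Lemma homog_act n g u : homog n u -> homog n (act g u).
Proof.
apply: (@homog_additive n n (act g)) => x xn /=; rewrite actU.
by apply: homogU; rewrite size_map.
Qed.

Lemma homog_app n b u : homog n u -> homog n.+1 (app b u).
Proof.
apply: (@homog_additive n n.+1 (app b)) => x xn /=; rewrite appU.
by apply: homogU; rewrite size_rcons xn.
Qed.

Lemma homog_pre1 n y u : homog n u -> homog n.+1 (pre [:: y] u).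
Proof.
apply: (@homog_additive n n.+1 (pre [:: y])) => x xn /=; rewrite preU.
by apply: homogU; rewrite /= xn.
Qed.

Lemma homog_norm n k c u : homog n u -> homog n (norm k c u).
Proof.
by move=> hu; apply: homog_sum => t; rewrite iter_act; apply: homog_act.
Qed.

Lemma homog_swap_out beta x : homog (size x) (swap_out beta x).
Proof.
elim: x => [|y x IH] /=; first exact: homogU.
by apply: homogD; [apply: homog_pre1 | apply/homogZsign/homog_app].
Qed.

Lemma homog_drop_out beta y x : homog (size x) (drop_out beta (y :: x)).
Proof.
elim: x y => [|z x IH] y.
  by rewrite /= raddf0 add0r; apply/homogZsign/homogU.
apply: homogD; first by apply: homog_pre1; apply: IH.
exact/homogZsign/homog_swap_out.
Qed.

Lemma homog_common_hbar k c beta n x : size x = n.+1 ->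
  homog n (common_hbar k c beta << x >>).
Proof.
case: x => //= y x [<-]; apply/homogN/homog_norm.
by rewrite linU; apply: homog_drop_out.
Qed.

Lemma homog_regular_hbar k base w n x : size x = n.+1 ->
  homog n (regular_hbar k base w << x >>).
Proof.
case: x => //= y x [<-]; rewrite regular_hbarU; apply/homog_norm/homog_act/homogU.
by rewrite size_belast.
Qed.

Lemma forget_diff n c : forget (rack_diff Q n c) = dw (forget c).
Proof.
apply: (@eq_rack _ _ (@forget n \o rack_diff Q n) (dw (Q:=Q) \o @forget n.+1)) => x /=.
rewrite forgetU /dw /= bdlU bd_tuple /rack_diff extendU raddf_sum -sumrN /=.
rewrite [RHS]big_mkcond [LHS]big_mkcond; apply: eq_bigr => i _.
case: posnP => [i0|_].
  by rewrite i0 !take0 subrr scaler0 oppr0.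
by rewrite raddfZsign raddfB /= !forgetU !val_face exprS mulN1r scaleNr.
Qed.

HB.instance Definition _ y n := GRing.isZmodMorphism.Build (rack_chain Q n)
  (rack_chain Q n) (@star Q y n) (lift_is_additive _).
HB.instance Definition _ b n := GRing.isZmodMorphism.Build (rack_chain Q n)
  (rack_chain Q n.+1) (@append Q b n) (lift_is_additive _).

Lemma forget_star n y (c : rack_chain Q n) : forget (star y c) = act (qop^~ y) (forget c).
Proof.
apply: (@eq_rack _ _ (@forget n \o @star Q y n) (act (qop^~ y) \o @forget n)) => x /=.
by rewrite /star extendU !forgetU actU.
Qed.

Lemma forget_append n b (c : rack_chain Q n) : forget (append b c) = app b (forget c).
Proof.
apply: (@eq_rack _ _ (@forget n.+1 \o @append Q b n) (app b \o @forget n)) => x /=.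
by rewrite /append extendU !forgetU appU.
Qed.

Lemma forget_iter_star n y t (c : rack_chain Q n) :
  forget (iter t (@star Q y n) c) = iter t (act (qop^~ y)) (forget c).
Proof. by elim: t => //= t IH; rewrite forget_star IH. Qed.

Definition rack_norm k y n (c : rack_chain Q n) := \sum_(t < k) iter t (@star Q y n) c.
Definition translate (v : seq Q) n (c : rack_chain Q n) := foldl (fun d y => star y d) c v.

Lemma forget_norm k y n (c : rack_chain Q n) :
  forget (rack_norm k y c) = norm k y (forget c).
Proof. by rewrite raddf_sum; apply: eq_bigr => t _; apply: forget_iter_star. Qed.

Lemma forget_hprime1 k y n (c : rack_chain Q n) :
  forget (hprime1 k y c) = norm k y (app y (forget c)).
Proof.
by rewrite raddf_sum; apply: eq_bigr => t _; rewrite -forget_append -forget_iter_star.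
Qed.

Lemma forget_translate v n (c : rack_chain Q n) :
  forget (translate v c) = act (foldl qop ^~ v) (forget c).
Proof.
elim: v c => [|y v IH] c /=.
  exact/esym/act_id.
by rewrite IH forget_star act_act.
Qed.

Lemma dw_app n b (c : rack_chain Q n) :
  dw (app b (forget c))
  = app b (dw (forget c)) - (-1) ^+ n *: (forget c - act (qop^~ b) (forget c)).
Proof.
apply: (@eq_rack _ _ (dw (Q:=Q) \o app b \o @forget n)
  ((app b \o dw (Q:=Q) \o @forget n)
   \- ( *:%R ((-1) ^+ n) \o (@forget n \- (act (qop^~ b) \o @forget n))))) => x /=.
rewrite !forgetU appU /dw /= !bdlU bd_rcons (raddfN (app b)) actU size_tuple.
by rewrite opprD.
Qed.

Lemma diff_append n b (c : rack_chain Q n.+1) :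
  rack_diff Q n.+1 (append b c)
  = append b (rack_diff Q n c) + (-1) ^+ n *: (c - star b c).
Proof.
apply: (can_inj (@forgetK _)); rewrite forget_diff forget_append dw_app -forget_diff.
rewrite (raddfD (@forget n.+1)) (raddfZsign (@forget n.+1)) (raddfB (@forget n.+1)) /=.
rewrite forget_append forget_star.
by rewrite exprS mulN1r scaleNr opprK.
Qed.

Lemma diff_star n y (c : rack_chain Q n.+1) :
  rack_diff Q n (star y c) = star y (rack_diff Q n c).
Proof.
apply: (can_inj (@forgetK _)); rewrite forget_diff !forget_star dw_act ?forget_diff //.
exact: qop_morphism.
Qed.

Lemma diff_hprime1 k a n (c : rack_chain Q n.+1) : k_condition k a ->
  rack_diff Q n.+1 (hprime1 k a c) = hprime1 k a (rack_diff Q n c).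
Proof.
move=> ak; apply: (can_inj (@forgetK _)).
rewrite forget_diff !forget_hprime1 norm_dw dw_app forget_diff raddfB raddfZsign.
by rewrite raddfB /= norm_act // subrr scaler0 subr0.
Qed.

Lemma hprime1_additive k a n : GRing.additive (@hprime1 Q k a n).
Proof.
move=> c d; apply: (can_inj (@forgetK _)).
rewrite forget_hprime1 (raddfB (@forget n)) (raddfB (@forget n.+1)) /=.
by rewrite !forget_hprime1 (raddfB (app a)) (raddfB (norm k a)).
Qed.
HB.instance Definition _ k a n := GRing.isZmodMorphism.Build (rack_chain Q n)
  (rack_chain Q n.+1) (@hprime1 Q k a n) (@hprime1_additive k a n).

Lemma hprime_chain_map s k (a : 'I_s -> Q) : (forall i, k_condition k (a i)) ->
  chain_map (hprime k a).
Proof.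
move=> ak; split=> [n c d|n c].
  by rewrite /hprime -big_split; apply: eq_bigr => i _; rewrite raddfD.
by rewrite /hprime raddf_sum; apply: eq_bigr => i _; apply: diff_hprime1.
Qed.

End RackChains.

(** * Homologous cycles *)

Section Homologous.
Variables (A : chain_complex) (n : nat).
Implicit Types z : A n.+1.

Definition homologous z z' := exists c, diff A n.+1 c = z - z'.

Lemma homologous_refl z : homologous z z.
Proof. by exists 0; rewrite raddf0 subrr. Qed.

Lemma homologous_trans z1 z2 z3 :
  homologous z1 z2 -> homologous z2 z3 -> homologous z1 z3.
Proof. by move=> [c dc] [d dd]; exists (c + d); rewrite raddfD dc dd addrA subrK. Qed.

Lemma homologous_sym z z' : homologous z z' -> homologous z' z.
Proof. by move=> [c dc]; exists (- c); rewrite raddfN dc opprB. Qed.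

Lemma homologousD z1 z2 z1' z2' :
  homologous z1 z1' -> homologous z2 z2' -> homologous (z1 + z2) (z1' + z2').
Proof. by move=> [c dc] [d dd]; exists (c + d); rewrite raddfD dc dd opprD addrACA. Qed.

Lemma homologous_sum_const m (F : 'I_m -> A n.+1) z :
  (forall i, homologous (F i) z) -> homologous (\sum_(i < m) F i) (z *+ m).
Proof.
move=> Fz; rewrite -[m in _ *+ m]card_ord -sumr_const.
elim/big_rec2: _ => [|i u v _ uv]; first exact: homologous_refl.
exact: homologousD.
Qed.

Lemma homologousMn z z' m : homologous z z' -> homologous (z *+ m) (z' *+ m).
Proof. by move=> [c dc]; exists (c *+ m); rewrite raddfMn dc mulrnBl. Qed.

Lemma eq_hclass (z z' : cycle_of A n) : homologous z z' -> hclass z = hclass z'.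
Proof.
move=> zz; apply/eqP; rewrite -Quotient.idealrBE inE; apply/asboolP.
by case: zz => c dc; exists c.
Qed.

End Homologous.

Lemma hclassMn (A : chain_complex) n (z : cycle_of A n) m :
  hclass (z *+ m) = hclass z *+ m.
Proof. by rewrite /hclass raddfMn. Qed.

Lemma homology_map_homologous (A : chain_complex) (f : forall n, A n -> A n) n m :
  chain_map f ->
  (forall z : A n.+1, diff A n z = 0 -> homologous (f n.+1 z) (z *+ m)) ->
  forall u : homology A n, homology_map f u = u *+ m.
Proof.
move=> fM fz u; rewrite -[u]reprK -/(hclass (repr u)); set z := repr u.
have z0 : diff A n (val z) = 0 by exact/eqP/(valP z).
have f0 : f n 0 = 0 by apply: (@addrI _ (f n 0)); rewrite -fM.1 !addr0.
have fz_cycle : f n.+1 (val z) \in @cycle_pred A n by rewrite inE fM.2 z0 f0.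
rewrite (@homology_mapE _ _ f n z (Cycle fz_cycle)) // -hclassMn.
apply: eq_hclass; have -> : cycle_val (z *+ m) = val z *+ m by exact: (raddfMn val).
exact: fz.
Qed.

Lemma homology_map_comp (A B C : chain_complex) (f : forall n, A n -> B n)
    (g : forall n, B n -> C n) n (u : homology A n) :
  chain_map f -> chain_map g ->
  homology_map (fun m => g m \o f m) u = homology_map g (homology_map f u).
Proof.
move=> fM gM; rewrite -[u]reprK -/(hclass (repr u)); set z := repr u.
have map0 (A' B' : chain_complex) (h : forall n, A' n -> B' n) :
    chain_map h -> forall m, h m 0 = 0.
  by move=> hM m; apply: (@addrI _ (h m 0)); rewrite -hM.1 !addr0.
have z0 : diff A n (val z) = 0 by exact/eqP/(valP z).
have fz : f n.+1 (val z) \in @cycle_pred B n by rewrite inE fM.2 z0 map0.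
have gz : g n.+1 (f n.+1 (val z)) \in @cycle_pred C n.
  by rewrite inE gM.2 (eqP fz) map0.
rewrite (@homology_mapE _ _ f n z (Cycle fz)) //.
rewrite (@homology_mapE _ _ g n (Cycle fz) (Cycle gz)) //.
apply: homology_mapE => //; split=> [m x y|m x] /=; first by rewrite fM.1 gM.1.
by rewrite gM.2 fM.2.
Qed.

Section Translations.
Variable Q : quandleType.
Local Notation R := (rack_complex Q).

(** Up to sign, appending y is a chain homotopy from the identity to the translation. *)
Lemma star_homologous y n (z : R n.+1) : diff R n z = 0 -> homologous (star y z : R n.+1) z.
Proof.
move=> z0; exists ((-1) ^+ n.+1 *: append y z).
rewrite (raddfZsign (rack_diff Q n.+1)) diff_append [rack_diff Q n z]z0 raddf0 add0r.
by rewrite scalerA -exprD addSn addnn -signr_odd oddS odd_double expr1 scaleN1r opprB.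
Qed.

Lemma star_cycle y n (z : R n.+1) : diff R n z = 0 -> diff R n (star y z) = 0.
Proof. by move=> z0; rewrite [LHS]diff_star [rack_diff Q n z]z0 raddf0. Qed.

Lemma translate_homologous v n (z : R n.+1) : diff R n z = 0 ->
  homologous (translate v z : R n.+1) z /\ diff R n (translate v z) = 0.
Proof.
elim: v z => [|y v IH] z z0 /=; first by split=> //; apply: homologous_refl.
have [h d0] := IH _ (star_cycle y z0); split=> //.
exact: homologous_trans h (star_homologous y z0).
Qed.

Lemma norm_homologous k y n (z : R n.+1) : diff R n z = 0 ->
  homologous (rack_norm k y z : R n.+1) (z *+ k) /\ diff R n (rack_norm k y z) = 0.
Proof.
move=> z0.
have iterE t : iter t (@star Q y n.+1) z = translate (nseq t y) z.
  by elim: t z {z0} => // t IH z; rewrite iterSr IH.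
split.
  apply: homologous_sum_const => t; rewrite iterE.
  by have [] := translate_homologous (nseq t y) z0.
rewrite /rack_norm (raddf_sum (diff R n)) big1 // => t _; rewrite iterE.
by have [] := translate_homologous (nseq t y) z0.
Qed.

Definition hprime_retraction k s (a : 'I_s -> Q) :=
  exists hbar : forall n : nat, shift_complex R n -> R n,
    chain_map hbar /\ forall (n : nat) (u : homology R n),
      homology_map (fun m => hbar m \o @hprime Q k s a m) u = u *+ (s * k ^ 2).

(** The exact expression of hbar h'_(a_i) is needed only up to translations (by v
and w) because these preserve the homology class of a cycle, and each norm contributes
a factor k. *)
Lemma hbar_of_words k s (a : 'I_s -> Q)
    (H : {additive {freeg (seq Q) / int} -> {freeg (seq Q) / int}}) :
  (forall i, k_condition k (a i)) ->
  (forall u, dw (H u) = H (dw u)) ->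
  (forall n x, size x = n.+1 -> homog n (H << x >>)) ->
  (forall i, exists v w c, forall u,
    H (act (foldl qop ^~ v) (norm k (a i) (app (a i) u)))
    = norm k c (act (foldl qop ^~ w) (norm k c (act (foldl qop ^~ v) u)))) ->
  hprime_retraction k a.
Proof.
move=> ak Hd Hhomog Ha.
pose hbar n (c : rack_chain Q n.+1) : rack_chain Q n := truncate n (H (forget c)).
have forget_hbar n (c : rack_chain Q n.+1) : forget (hbar n c) = H (forget c).
  by apply: forget_homog => x; apply: Hhomog.
have hbarD n (c d : rack_chain Q n.+1) : hbar n (c + d) = hbar n c + hbar n d.
  by rewrite /hbar !raddfD.
have hbarM : chain_map (hbar : forall n : nat, shift_complex R n -> R n).
  split=> [|n c]; first exact: hbarD.
  apply: (can_inj (@forgetK _ _)); rewrite [LHS]forget_diff !forget_hbar Hd.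
  by rewrite [in RHS]forget_diff.
have h'M := hprime_chain_map ak.
exists hbar; split=> // n; apply: homology_map_homologous => [|z z0].
  split=> [m c d|m c] /=; first by rewrite h'M.1 hbarM.1.
  by rewrite hbarM.2 h'M.2.
have hbar0 m : hbar m 0 = 0 by rewrite /hbar !raddf0.
have hbar_sum m (F : 'I_s -> rack_chain Q m.+1) :
    hbar m (\sum_i F i) = \sum_i hbar m (F i).
  by apply: (big_morph _ (hbarD m) (hbar0 m)).
rewrite /= /hprime hbar_sum mulnC mulrnA; apply: homologous_sum_const => i.
have [v [w [c Hi]]] := Ha i.
have y0 : diff R n.+1 (hprime1 k (a i) z) = 0.
  by rewrite [LHS]diff_hprime1 // [rack_diff Q n z]z0 raddf0.
have [[d dd] _] := translate_homologous v y0.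
apply: (@homologous_trans R n _ (hbar n.+1 (translate v (hprime1 k (a i) z)))).
  apply: homologous_sym; exists (hbar n.+2 d).
  rewrite [LHS]hbarM.2 -[diff _ _ d]/(diff R n.+2 d) dd.
  by rewrite /hbar !raddfB.
have -> : hbar n.+1 (translate v (hprime1 k (a i) z))
    = rack_norm k c (translate w (rack_norm k c (translate v z))).
  apply: (can_inj (@forgetK _ _)).
  by rewrite forget_hbar forget_norm !forget_translate forget_norm forget_translate
    forget_hprime1 Hi.
have [h1 c1] := translate_homologous v z0.
have [h2 c2] := norm_homologous k c c1.
have [h3 c3] := translate_homologous w c2.
have [h4 _] := norm_homologous k c c3.
apply: homologous_trans h4 _; rewrite mulrnA; apply: homologousMn.
exact: homologous_trans h3 (homologous_trans h2 (homologousMn k h1)).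
Qed.

End Translations.

(** * Orbits and regularity *)

Section Orbits.
Variable Q : quandleType.
Implicit Types x y z : Q.

Lemma qop_inj y : injective (fun x => x *> y).
Proof.
move=> x z xz; have [c [_ cU]] := qop_div (x *> y) y.
by rewrite -(cU x) // -(cU z).
Qed.

Lemma foldl_qop_inj (v : seq Q) : injective (foldl qop ^~ v).
Proof. by elim: v => [|y v IH] x z //= /IH /qop_inj. Qed.

Lemma foldl_qop_nseq n y : foldl qop y (nseq n y) = y.
Proof. by elim: n => //= n IH; rewrite qopxx. Qed.

Lemma qorbit_refl x : qorbit x x.
Proof. by exists id => //; apply: inner_id. Qed.

Lemma qorbit_qop x y z : qorbit x y -> qorbit x (y *> z).
Proof. by move=> [f fI <-]; exists (fun x => f x *> z) => //; apply: inner_mul. Qed.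

Lemma qorbit_iter x y z n : qorbit x y -> qorbit x (iter n (qop^~ z) y).
Proof. by move=> xy; elim: n => //= n; apply: qorbit_qop. Qed.

(** Paths ending at y can be prolonged by the letter y, which fixes y. *)
Lemma connected_padded j x y : (exists2 i, (i <= j)%N & connected i x y) ->
  exists2 v : seq Q, size v = j & foldl qop x v = y.
Proof.
move=> [i ij [t xt]]; exists (t ++ nseq (j - i) y).
  by rewrite size_cat size_tuple size_nseq subnKC.
by rewrite foldl_cat xt foldl_qop_nseq.
Qed.

Lemma regular_foldl j x y (v w : seq Q) z : regular j x -> size v = j -> size w = j ->
  foldl qop y v = x -> foldl qop y w = x -> foldl qop z v = foldl qop z w.
Proof.
move=> reg /eqP vj /eqP wj yv yw.
apply: (reg (foldl qop ^~ v) (foldl qop ^~ w)).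
- by exists (Tuple vj).
- by exists (Tuple wj).
- by exists y.
Qed.

(** If x * c = a then also x * b = a for some b in the orbit of a. Following both by
j - 1 translations by a, which fix a, gives inner automorphisms of length j taking x to
a; they are equal by regularity, and cancelling the last j - 1 steps shows that b and c
act in the same way. *)
Lemma quasigroup_translation k j c a : (0 < k)%N -> k_condition k c ->
  (0 < j)%N -> regular j a -> orbit_quasigroup a ->
  exists b w, [/\ qorbit a b, a *> w = b & forall y, y *> b = y *> c].
Proof.
case: k => // k _ ck; case: j => // j _ reg quasi.
pose x := iter k (qop^~ c) a.
have xc : x *> c = a by rewrite /x -[RHS](ck a).
have ax : qorbit a x by apply/qorbit_iter/qorbit_refl.
have [b [[ab xb] _]] := quasi _ _ ax (qorbit_refl a).
have [w [[_ aw] _]] := quasi _ _ (qorbit_refl a) ab.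
exists b, w; split=> // y; apply: (@foldl_qop_inj (nseq j a)).
by apply: (@regular_foldl j.+1 a x (b :: nseq j a) (c :: nseq j a));
  rewrite //= ?size_nseq // ?xb ?xc foldl_qop_nseq.
Qed.

Section Hbar.
Variables (s k : nat) (a : 'I_s -> Q).
Hypothesis k_gt0 : (0 < k)%N.
Hypothesis orbits : forall x : Q, exists! i : 'I_s, qorbit (a i) x.
Hypothesis ak : forall i : 'I_s, k_condition k (a i).

Lemma orbit_index : exists o : Q -> 'I_s,
  [/\ forall x, qorbit (a (o x)) x, forall x y, o (x *> y) = o x
    & forall i x, qorbit (a i) x -> o x = i].
Proof.
have /boolp.choice[o oP] : forall x, exists i, qorbit (a i) x.
  by move=> x; have [i [ix _]] := orbits x; exists i.
have oE i x : qorbit (a i) x -> o x = i.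
  by move=> ix; have [l [_ lU]] := orbits x; rewrite -(lU _ (oP x)) -(lU _ ix).
exists o; split=> // x y; apply: oE; exact/qorbit_qop/oP.
Qed.

Lemma hbar_quasigroup j : (0 < j)%N -> (forall i, regular j (a i)) ->
  (forall x : Q, orbit_quasigroup x) -> hprime_retraction k a.
Proof.
move=> j_gt0 reg quasi; case: (posnP s) => [s0|s_gt0].
  (* Without orbits there is no c to norm by, but the zero map will do. *)
  apply: (@hbar_of_words _ _ _ _ \0) => //= [u|n x _|i].
  - by rewrite raddf0.
  - exact: homog0.
  - by case: i => i; rewrite s0.
pose c := a (Ordinal s_gt0).
have [o [oP o_qop oE]] := orbit_index.
have /boolp.choice[b bP] : forall i, exists b w,
    [/\ qorbit (a i) b, a i *> w = b & forall y, y *> b = y *> c].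
  by move=> i; apply: (quasigroup_translation k_gt0 (ak _) j_gt0).
have bc i y : y *> b i = y *> c by have [w []] := bP i.
apply: (@hbar_of_words _ _ _ _ (common_hbar k c (b \o o))) => //= [u|n x xn|i].
- apply: common_hbar_dw => [|y|y z|y z] /=; first exact: ak.
  + by rewrite -(bc (o y)) qopxx.
  + by rewrite o_qop.
  + exact: bc.
- exact: homog_common_hbar.
have [w [abi aw _]] := bP i; exists [:: w], [::], c => u.
rewrite act_norm; last exact: qop_morphism.
rewrite act_app /= aw norm_app_self (eq_norm _ _ (bc i)) common_hbar_app /=.
  by rewrite [act (fun z => z) _]act_id.
by rewrite (oE i).
Qed.

Lemma hbar_connected j : (forall i, orbit_connected j (a i)) ->
  (forall i, regular j.+1 (a i)) -> hprime_retraction k a.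
Proof.
move=> conn reg; have [o [oP o_qop oE]] := orbit_index.
have /boolp.choice[w wP] : forall y, exists v : seq Q,
    size v = j /\ foldl qop y v = a (o y).
  move=> y; have [v vj yv] := connected_padded (conn _ _ (oP y)).
  by exists v.
have oa i : o (a i) = i by apply/oE/qorbit_refl.
apply: (@hbar_of_words _ _ _ _ (regular_hbar k (a \o o) w)) => //= [u|n x xn|i].
- apply: regular_hbar_dw => [y|y z|y z x] /=; first exact: ak.
    by rewrite o_qop.
  have [wj yw] := wP y; have [wj' yw'] := wP (y *> z).
  rewrite -(foldl_rcons qop x (w y) (a (o y))).
  apply: (@regular_foldl j.+1 (a (o y)) y (z :: w (y *> z)) (rcons (w y) (a (o y)))).
  + exact: reg.
  + by rewrite /= wj'.
  + by rewrite size_rcons wj.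
  + by rewrite /= yw' o_qop.
  + by rewrite foldl_rcons yw qopxx.
- exact: homog_regular_hbar.
exists [::], (w (a i)), (a i) => u.
by rewrite ![act (foldl qop ^~ [::]) _]act_id norm_app_self regular_hbar_app /= oa.
Qed.

End Hbar.
End Orbits.

Lemma homology_map_inj (A B : chain_complex) (f : forall n, A n -> B n)
    (g : forall n, B n -> A n) n s k :
  chain_map f -> chain_map g ->
  (forall u : homology A n,
    homology_map (fun m => g m \o f m) u = u *+ (s * k ^ 2)) ->
  (forall u : homology A n, u *+ (s * k) = 0 -> u = 0) ->
  injective (fun u : homology A n => homology_map f u).
Proof.
move=> fM gM gf tf u v /= fuv; apply/eqP; rewrite -subr_eq0; apply/eqP.
have uv : (u - v) *+ (s * k ^ 2) = 0.
  by rewrite mulrnBl -(gf u) -(gf v) (homology_map_comp u fM gM)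
    (homology_map_comp v fM gM) fuv subrr.
have uvk : (u - v) *+ k = 0 by apply: tf; rewrite -mulrnA mulnCA.
by apply: tf; rewrite mulnC mulrnA uvk mul0rn.
Qed.

Theorem theorem2p4 (Q : quandleType) (s k : nat) (a : 'I_s -> Q) :
  (0 < k)%N ->
  (forall x : Q, exists! i : 'I_s, qorbit (a i) x) ->
  (forall i : 'I_s, k_condition k (a i)) ->
  let R := rack_complex Q in
  let h' := hprime k a in
  let case1 (j : nat) :=
    [/\ (0 < j)%N, forall i : 'I_s, regular j (a i)
      & forall x : Q, orbit_quasigroup x] in
  let case2 (j : nat) :=
    (forall i : 'I_s, orbit_connected j (a i)) /\
    (forall i : 'I_s, regular j.+1 (a i)) in
  let conclusion :=
    exists hbar : forall n : nat, shift_complex R n -> R n,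
      chain_map hbar /\
      forall (n : nat) (u : homology R n),
        homology_map (fun m => hbar m \o h' m) u = u *+ (s * k ^ 2) in
  [/\ chain_map h',
      forall j : nat, case1 j -> conclusion,
      forall j : nat, case2 j -> conclusion
    & forall n : nat,
        (exists j : nat, case1 j \/ case2 j) ->
        (forall u : homology R n, u *+ (s * k) = 0 -> u = 0) ->
        injective (fun u : homology R n => homology_map h' u)].
Proof.
move=> k_gt0 orbits ak R h' case1 case2 conclusion.
have h'M : chain_map h' := hprime_chain_map ak.
have c1 j : case1 j -> conclusion.
  by move=> [j0 reg quasi]; apply: (hbar_quasigroup k_gt0 orbits ak j0).
have c2 j : case2 j -> conclusion.
  by move=> [conn reg]; apply: (hbar_connected orbits ak conn reg).
split=> // n [j cj] torsion_free.
have [hbar [hbarM hbarh']] : conclusion by case: cj; [apply: c1 | apply: c2].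
exact: (homology_map_inj h'M hbarM (hbarh' n) torsion_free).
Qed.
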